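(* Let $q\in\mathbb C$ with $|q|<1$. For each $n\ge1$ let $\partial_n$ be the $\mathcal C$-linear derivation of $\mathfrak H$ with \[ \partial_n(\mathbf a)=\frac{(-1)^n}{n}\mathbf a\{\mathbf a(\mathbf b+1)+\hbar\mathbf b\}^{n-1}(\mathbf a+\hbar)\mathbf b,\qquad \partial_n(\mathbf b)=\frac{(-1)^{n-1}}{n}\mathbf a\{(\mathbf b+1)\mathbf a+\hbar\mathbf b\}^{n-1}(\mathbf b+1)\mathbf b. \] Then $Z_q(\partial_n(w))=0$ for every $n\ge1$ and every $w\in\widehat{\mathfrak H^0}$.
   Context: Let $\hbar$ be a formal variable, $\mathcal{C}=\mathbb{Q}[\hbar,\hbar^{-1}]$, and $\mathfrak{H}=\mathcal{C}\langle \mathbf{a},\mathbf{b}\rangle$ the non-commutative polynomial ring over $\mathcal{C}$. Let $\widehat{\mathbb{N}}=\{\overline{1}\}\sqcup\mathbb{N}$, $\overline1$ a new symbol. Put $e_{\overline{1}}=\mathbf{a}\mathbf{b}$ and $e_k=\mathbf{a}^{k-1}(\mathbf{a}+\hbar)\mathbf{b}$ for $k\ge 1$. An index is a tuple $\mathbf k=(k_1,\dots,k_r)$, $r\ge0$, of elements of $\widehat{\mathbb N}$, and $e_{\mathbf k}=e_{k_1}\cdots e_{k_r}$ ($e_\emptyset=1$). $\widehat{\mathfrak H^0}$ is the $\mathcal C$-submodule of $\mathfrak H$ spanned by $e_{\mathbf k}$ for indices $\mathbf k$ that are empty or satisfy $k_1\ne1$; these $e_{\mathbf k}$ form a $\mathcal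 C$-basis. For $m\ge1$ let $[m]=(1-q^m)/(1-q)$, $F_{\overline1}(m)=q^m/[m]$ and $F_k(m)=q^{(k-1)m}/[m]^k$ ($k\ge1$). For a nonempty index $\mathbf k=(k_1,\dots,k_r)$ with $k_1\ne1$ put $\zeta_q(\mathbf k)=\sum_{m_1>\cdots>m_r\ge1}\prod_{j=1}^rF_{k_j}(m_j)$ (absolutely convergent), and $\zeta_q(\emptyset)=1$. Regard $\mathbb C$ as a $\mathcal C$-module with $\hbar$ acting as multiplication by $1-q$. $Z_q:\widehat{\mathfrak H^0}\to\mathbb C$ is the $\mathcal C$-linear map with $Z_q(e_{\mathbf k})=\zeta_q(\mathbf k)$. *)

(* Defs.v *)
From HB Require Import structures.
From mathcomp Require Import all_boot all_order all_algebra.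
From mathcomp Require Import finmap.
From mathcomp.multinomials Require Import monalg.
From mathcomp Require Import complex.
From mathcomp Require Import boolp classical_sets reals topology normedtype.
From mathcomp Require Import sequences.

Set Implicit Arguments.
Unset Strict Implicit.
Unset Printing Implicit Defensive.

Import Order.TTheory GRing.Theory Num.Theory.
Import numFieldNormedType.Exports.

Local Open Scope ring_scope.

(* The field of complex numbers over R; going through numClosedFieldType gives
   it the topology of its norm. *)
Definition Cplx (R : realType) : numClosedFieldType := R[i].

(* -------------------------------------------------------------------- *)
(* The Laurent polynomial ring QQ[hbar, hbar^-1], as the subring of QQ(hbar)
   of the fractions whose denominator is a power of the variable. *)

Local Notation "x %:F" := (@FracField.tofrac _ x).

Definition is_laurent : {pred {fraction {poly rat}}} :=
  fun x => `[< exists n (p : {poly rat}), x = p%:F / 'X%:F ^+ n >].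

Lemma Xfrac_neq0 n : 'X%:F ^+ n != 0 :> {fraction {poly rat}}.
Proof. by rewrite expf_neq0 // tofrac_eq0 polyX_eq0. Qed.

Lemma is_laurent_subring : subring_closed is_laurent.
Proof.
split=> [|x y|x y].
- by apply/asboolP; exists 0%N, 1; rewrite expr0 divr1 tofrac1.
- move=> /asboolP[n [p ->]] /asboolP[m [r ->]]; apply/asboolP.
  exists (n + m)%N, (p * 'X^m - r * 'X^n).
  rewrite -mulNr addf_div ?Xfrac_neq0 // -exprD; congr (_ / _).
  by rewrite tofracB !tofracM !tofracXn mulNr.
- move=> /asboolP[n [p ->]] /asboolP[m [r ->]]; apply/asboolP.
  by exists (n + m)%N, (p * r); rewrite mulf_div -exprD tofracM.
Qed.

HB.instance Definition _ :=
  GRing.isSubringClosed.Build _ is_laurent is_laurent_subring.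

Record laurent := Laurent { laurent_val : {fraction {poly rat}};
                            laurentP : laurent_val \in is_laurent }.

HB.instance Definition _ := [isSub for laurent_val].
HB.instance Definition _ := [Choice of laurent by <:].
HB.instance Definition _ := [SubChoice_isSubComNzRing of laurent by <:].

Fact laurentC_subproof (r : rat) : (r%:P)%:F \in is_laurent.
Proof. by apply/asboolP; exists 0%N, r%:P; rewrite expr0 divr1. Qed.

Definition laurentC (r : rat) : laurent := Laurent (laurentC_subproof r).

Fact hbar_subproof : 'X%:F \in is_laurent.
Proof. by apply/asboolP; exists 0%N, 'X; rewrite expr0 divr1. Qed.

Definition hbar : laurent := Laurent hbar_subproof.

(* Evaluation at hbar := t, meant for t != 0 (see laurent_evalE). *)
Definition laurent_eval (K : numFieldType) (t : K) (c : laurent) : K :=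
  let np := xget (0%N, 0)
    [set np : nat * {poly rat} | laurent_val c = np.2%:F / 'X%:F ^+ np.1]%classic
  in (map_poly ratr np.2).[t] / t ^+ np.1.

Section LaurentEval.
Variables (K : numFieldType) (t : K).
Hypothesis t0 : t != 0.

Lemma laurent_evalE (c : laurent) n p :
  laurent_val c = p%:F / 'X%:F ^+ n ->
  laurent_eval t c = (map_poly ratr p).[t] / t ^+ n.
Proof.
move=> cE; rewrite /laurent_eval; case: xgetP => [[m r] _ /= cE'|/(_ (n, p))//].
have prE : p * 'X^m = r * 'X^n.
  apply/eqP; rewrite -tofrac_eq !tofracM !tofracXn.
  by rewrite -eqr_div ?Xfrac_neq0 // -cE -cE'.
have := congr1 (fun s => (map_poly (@ratr K) s).[t]) prE.
rewrite !rmorphM /= !map_polyXn !hornerM !hornerXn => ptE.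
by apply/eqP; rewrite eqr_div ?expf_neq0 // ptE.
Qed.

Lemma laurent_eval_zmod : zmod_morphism (laurent_eval t).
Proof.
move=> c d; have tn k : t ^+ k != 0 by rewrite expf_neq0.
have /asboolP[n [p cE]] := laurentP c; have /asboolP[m [r dE]] := laurentP d.
rewrite (laurent_evalE cE) (laurent_evalE dE).
rewrite (@laurent_evalE _ (n + m)%N (p * 'X^m - r * 'X^n)).
  rewrite rmorphB !rmorphM /= !map_polyXn hornerD hornerN !hornerM !hornerXn.
  by rewrite -!mulNr addf_div // -exprD.
rewrite -[LHS]/(laurent_val c - laurent_val d) cE dE.
rewrite -mulNr addf_div ?Xfrac_neq0 // -exprD; congr (_ / _).
by rewrite tofracB !tofracM !tofracXn mulNr.
Qed.

Lemma laurent_eval_monoid : monoid_morphism (laurent_eval t).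
Proof.
split=> [|c d].
  rewrite (@laurent_evalE _ 0 1) expr0 divr1 ?rmorph1 ?hornerC //.
have /asboolP[n [p cE]] := laurentP c; have /asboolP[m [r dE]] := laurentP d.
rewrite (laurent_evalE cE) (laurent_evalE dE) (@laurent_evalE _ (n + m) (p * r)).
  by rewrite rmorphM hornerM exprD mulf_div.
by rewrite -[LHS]/(laurent_val c * laurent_val d) cE dE mulf_div -exprD tofracM.
Qed.

Lemma laurent_eval_hbar : laurent_eval t hbar = t.
Proof.
rewrite (@laurent_evalE _ 0 'X) ?expr0 ?divr1 //.
by rewrite map_polyX hornerX.
Qed.

Lemma laurent_evalC r : laurent_eval t (laurentC r) = ratr r.
Proof.
rewrite (@laurent_evalE _ 0 r%:P) ?expr0 ?divr1 //.
by rewrite map_polyC hornerC.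
Qed.

End LaurentEval.

(* -------------------------------------------------------------------- *)
(* H is the monoid algebra of the free monoid on two letters, where true stands
   for a and false for b. *)

Definition word : Type := seq bool.

HB.instance Definition _ := Choice.on word.

Fact word_unit (u v : word) : u ++ v = [::] -> u = [::] /\ v = [::].
Proof. by case: u v => [|? ?] []. Qed.

HB.instance Definition _ := Choice_isMonomialDef.Build word
  (@catA bool) (@cat0s bool) (@cats0 bool) word_unit.

Notation Halg := {malg laurent[word]}.

Lemma Halg_scaleAr (c : laurent) (x y : Halg) : c *: (x * y) = x * (c *: y).
Proof.
rewrite -!mul_malgC !mulrA; congr (_ * y); apply/malgP => k.
rewrite mcoeffCM (mcoeffMrw _ (fsubset_refl _) msuppU_le) big_seq_fset1.
rewrite [x in LHS]monalgE raddf_sum mulr_sumr /=; apply: eq_bigr => u _.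
by rewrite mcoeffUU mcoeffU mulm1 mulrnAr mulrC.
Qed.

Definition gen_a : Halg := << ([:: true] : word) >>.
Definition gen_b : Halg := << ([:: false] : word) >>.

(* The laurent-linear derHation of Halg sending a to x and b to y; on a word
   it is given by the Leibniz rule. *)
Fixpoint derH_word (x y : Halg) (u : word) : Halg :=
  if u is l :: v then
    (if l then x else y) * << (v : word) >>
      + << ([:: l] : word) >> * derH_word x y v
  else 0.

Definition derH (x y w : Halg) : Halg :=
  \sum_(u <- msupp w) w@_u *: derH_word x y u.

Section DerH.
Variables x y : Halg.

Lemma derH_sumw (d : {fset word}) w : (msupp w `<=` d)%fset ->
  derH x y w = \sum_(u <- d) w@_u *: derH_word x y u.
Proof.
move=> le; rewrite /derH (big_fset_incl _ le) //= => u _ /mcoeff_outdom ->.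
by rewrite scale0r.
Qed.

Lemma derHD w1 w2 : derH x y (w1 + w2) = derH x y w1 + derH x y w2.
Proof.
rewrite (derH_sumw (msuppD_le w1 w2)) (derH_sumw (fsubsetUl _ (msupp w2))).
rewrite (derH_sumw (fsubsetUr (msupp w1) _)) -big_split /=.
by apply: eq_bigr => u _; rewrite mcoeffD scalerDl.
Qed.

Lemma derHZ c w : derH x y (c *: w) = c *: derH x y w.
Proof.
rewrite (derH_sumw (msuppZ_le c w)) scaler_sumr; apply: eq_bigr => u _.
by rewrite mcoeffZ scalerA.
Qed.

Lemma derH_is_linear : linear (derH x y).
Proof. by move=> c u v; rewrite derHD derHZ. Qed.

HB.instance Definition _ :=
  GRing.isLinear.Build laurent Halg Halg _ (derH x y) derH_is_linear.

Lemma derHU u : derH x y << u >> = derH_word x y u.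
Proof.
by rewrite (derH_sumw msuppU_le) big_seq_fset1 mcoeffUU scale1r.
Qed.

Lemma derH_a : derH x y gen_a = x.
Proof. by rewrite derHU /= mulr0 addr0 mulr1. Qed.

Lemma derH_b : derH x y gen_b = y.
Proof. by rewrite derHU /= mulr0 addr0 mulr1. Qed.

Lemma mulU (u v : word) : << u >> * << v >> = << ((u ++ v)%SEQ : word) >> :> Halg.
Proof. by rewrite malgM_def fgmulUU mulr1. Qed.

Lemma malg_wordE (w : Halg) : w = \sum_(u <- msupp w) w@_u *: << u >>.
Proof.
rewrite {1}[w]monalgE; apply: eq_bigr => u _.
by rewrite -mul_malgC malgM_def fgmulUU mulr1 mul1m.
Qed.

Lemma derHM w1 w2 : derH x y (w1 * w2) = derH x y w1 * w2 + w1 * derH x y w2.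
Proof.
rewrite (malg_wordE w2) mulr_sumr !linear_sum !mulr_sumr -big_split /=.
apply: eq_bigr => v _; rewrite -Halg_scaleAr !derHZ -!Halg_scaleAr -scalerDr.
congr (_ *: _); rewrite (malg_wordE w1) mulr_suml !linear_sum !mulr_suml -big_split /=.
apply: eq_bigr => u _; rewrite -scalerAl !derHZ -!scalerAl -scalerDr.
congr (_ *: _); rewrite mulU !derHU; elim: u => [|l u IHu] /=.
  by rewrite mul0r add0r mul1r.
by rewrite IHu mulrDl mulrDr -!mulrA mulU !addrA !mulrA mulU.
Qed.

End DerH.

(* Only n >= 1 is meaningful: the constants have denominator n. *)
Definition partialH (n : nat) : Halg -> Halg :=
  derH
    (laurentC ((-1) ^+ n / n%:R) *:
       (gen_a * (gen_a * (gen_b + 1) + hbar *: gen_b) ^+ n.-1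
          * (gen_a + hbar%:A) * gen_b))
    (laurentC ((-1) ^+ n.-1 / n%:R) *:
       (gen_a * ((gen_b + 1) * gen_a + hbar *: gen_b) ^+ n.-1
          * (gen_b + 1) * gen_b)).

(* -------------------------------------------------------------------- *)

Inductive Nhat : Type := Bar1 | Num (k : nat) of (0 < k)%N.

Definition eNhat (k : Nhat) : Halg :=
  match k with
  | Bar1 => gen_a * gen_b
  | Num k _ => gen_a ^+ k.-1 * (gen_a + hbar%:A) * gen_b
  end.

Definition eindex (ks : seq Nhat) : Halg := \prod_(k <- ks) eNhat k.

Definition admissible (ks : seq Nhat) : bool :=
  if ks is Num k _ :: _ then k != 1%N else true.

(* s is a list of coefficients and admissible indices expressing w as an
   element of the span of the corresponding e_k. *)
Definition expansion (w : Halg) (s : seq (laurent * seq Nhat)) : Prop :=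
  all (fun p => admissible p.2) s /\ w = \sum_(p <- s) p.1 *: eindex p.2.

Definition H0hat (w : Halg) : Prop := exists s, expansion w s.

(* -------------------------------------------------------------------- *)

Section Zeta.
Variables (R : realType) (q : Cplx R).

Definition qint (m : nat) : Cplx R := (1 - q ^+ m) / (1 - q).

Definition Fq (k : Nhat) (m : nat) : Cplx R :=
  match k with
  | Bar1 => q ^+ m / qint m
  | Num k _ => q ^+ (k.-1 * m) / qint m ^+ k
  end.

(* The part of the series with N >= m_1 > ... > m_r >= 1; as the series
   converges absolutely, its sum is the limit of these parts. *)
Definition zeta_trunc (ks : seq Nhat) (N : nat) : Cplx R :=
  \sum_(m : (size ks).-tuple 'I_N.+1
        | sorted gtn [seq val i | i <- m] && all (fun i : 'I_N.+1 => 0 < i)%N m)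
    \prod_(j < size ks) Fq (tnth (in_tuple ks) j) (tnth m j).

Definition zeta (ks : seq Nhat) : Cplx R :=
  limn (fun N => zeta_trunc ks N).

(* The value at w of the linear map e_k |-> zeta k, read off any expansion of
   w; see Zq_expansion for the independence of the choice. *)
Definition Zq (w : Halg) : Cplx R :=
  xget 0 [set z : Cplx R | exists2 s, expansion w s &
    z = \sum_(p <- s) laurent_eval (1 - q) p.1 * zeta p.2]%classic.

End Zeta.

(* -------------------------------------------------------------------- *)
(* For every f on indices there is a map on Halg, semilinear along
   hbar |-> t, sending e_k to f k: it is built from the expansion of each
   a^k b in terms of the e_i. *)
Section Functional.
Variables (K : numFieldType) (t : K).
Hypothesis t0 : t != 0.

Fixpoint block (k : nat) (g : Nhat -> K) : K :=
  match k with
  | 0%N => t^-1 * (g (@Num 1 isT) - g Bar1)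
  | 1%N => g Bar1
  | k'.+1 => g (@Num k'.+1 isT) - t * block k' g
  end.

Fixpoint wordval (k : nat) (f : seq Nhat -> K) (u : word) : K :=
  match u with
  | [::] => f [::] *+ (k == 0%N)
  | true :: v => wordval k.+1 f v
  | false :: v => block k (fun i => wordval 0 (fun s => f (i :: s)) v)
  end.

Definition Hval (f : seq Nhat -> K) (w : Halg) : K :=
  \sum_(u <- msupp w) laurent_eval t w@_u * wordval 0 f u.

Lemma laurent_eval0 : laurent_eval t 0 = 0.
Proof. by have := laurent_eval_zmod t0 0 0; rewrite !subrr. Qed.

Lemma laurent_evalN c : laurent_eval t (- c) = - laurent_eval t c.
Proof. by rewrite -[- c]add0r laurent_eval_zmod // laurent_eval0 add0r. Qed.

Lemma laurent_evalD c d :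
  laurent_eval t (c + d) = laurent_eval t c + laurent_eval t d.
Proof. by rewrite -{1}[d]opprK laurent_eval_zmod // laurent_evalN opprK. Qed.

Lemma Hval_sumw f (d : {fset word}) w : (msupp w `<=` d)%fset ->
  Hval f w = \sum_(u <- d) laurent_eval t w@_u * wordval 0 f u.
Proof.
move=> le; rewrite /Hval (big_fset_incl _ le) //= => u _ /mcoeff_outdom ->.
by rewrite laurent_eval0 mul0r.
Qed.

Lemma HvalD f w1 w2 : Hval f (w1 + w2) = Hval f w1 + Hval f w2.
Proof.
rewrite (Hval_sumw f (msuppD_le w1 w2)) (Hval_sumw f (fsubsetUl _ (msupp w2))).
rewrite (Hval_sumw f (fsubsetUr (msupp w1) _)) -big_split /=.
by apply: eq_bigr => u _; rewrite mcoeffD laurent_evalD mulrDl.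
Qed.

Lemma HvalZ f c w : Hval f (c *: w) = laurent_eval t c * Hval f w.
Proof.
rewrite (Hval_sumw f (msuppZ_le c w)) mulr_sumr; apply: eq_bigr => u _.
by rewrite mcoeffZ (laurent_eval_monoid t0).2 mulrA.
Qed.

Lemma Hval0 f : Hval f 0 = 0.
Proof. by rewrite /Hval msupp0 big_seq_fset0. Qed.

Lemma Hval_sum f I (s : seq I) (F : I -> Halg) :
  Hval f (\sum_(i <- s) F i) = \sum_(i <- s) Hval f (F i).
Proof. exact: (big_morph _ (HvalD f) (Hval0 f)). Qed.

Lemma HvalU f u : Hval f << u >> = wordval 0 f u.
Proof.
rewrite (Hval_sumw f msuppU_le) big_seq_fset1 mcoeffUU.
by rewrite (laurent_eval_monoid t0).1 mul1r.
Qed.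

Lemma wordval_block f i k v :
  wordval i f (nseq k true ++ false :: v) =
  block (k + i) (fun j => wordval 0 (fun s => f (j :: s)) v).
Proof. by elim: k i => //= k IHk i; rewrite IHk addnS. Qed.

Lemma gen_aX k : gen_a ^+ k = << (nseq k true : word) >>.
Proof. by elim: k => // k IHk; rewrite exprS IHk mulU. Qed.

Lemma Hval_eM f k v :
  Hval f (eNhat k * v) = Hval (fun s => f (k :: s)) v.
Proof.
rewrite (malg_wordE v) mulr_sumr !Hval_sum; apply: eq_bigr => u _.
rewrite -Halg_scaleAr !HvalZ; congr (_ * _); rewrite HvalU.
case: k => [|[//|k] kP] /=.
  by rewrite -mulrA !mulU HvalU.
rewrite (eq_irrelevance kP isT) mulrDr -exprSr -Halg_scaleAr mulr1 !mulrDl.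
rewrite -!scalerAl !gen_aX !mulU HvalD HvalZ !HvalU laurent_eval_hbar //.
rewrite -!catA !wordval_block !addn0 -/(nseq k.+1 true).
case: k {kP} => [|k] /=; first by rewrite mulrA mulfV // mul1r addrC subrK.
by rewrite subrK.
Qed.

Lemma Hval_eindex f ks : Hval f (eindex ks) = f ks.
Proof.
rewrite /eindex; elim: ks f => [|k ks IHks] f.
  by rewrite big_nil HvalU.
by rewrite big_cons Hval_eM IHks.
Qed.

End Functional.

Section ZqTheory.
Variables (R : realType) (q : Cplx R).
Hypothesis q1 : 1 - q != 0.

Lemma Zq_expansion w s : expansion w s ->
  Zq q w = \sum_(p <- s) laurent_eval (1 - q) p.1 * zeta q p.2.
Proof.
have HvalE s' : expansion w s' -> Hval (1 - q) (zeta q) w =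
    \sum_(p <- s') laurent_eval (1 - q) p.1 * zeta q p.2.
  case=> _ ->; rewrite Hval_sum //; apply: eq_bigr => p _.
  by rewrite HvalZ // Hval_eindex.
move=> ws; rewrite /Zq; case: xgetP => [z _ [s' ws' ->]|noz].
  by rewrite -(HvalE _ ws) -(HvalE _ ws').
by case: (noz _ (ex_intro2 _ _ s ws erefl)).
Qed.

Lemma Zq_eindex ks : admissible ks -> Zq q (eindex ks) = zeta q ks.
Proof.
move=> adm; rewrite (@Zq_expansion _ [:: (1, ks)]).
  by rewrite big_seq1 (laurent_eval_monoid q1).1 mul1r.
by split; rewrite /= ?adm // big_seq1 scale1r.
Qed.

Lemma Zq_linear c w1 w2 : H0hat w1 -> H0hat w2 ->
  Zq q (c *: w1 + w2) = laurent_eval (1 - q) c * Zq q w1 + Zq q w2.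
Proof.
move=> [s1 e1] [s2 e2]; rewrite (Zq_expansion e1) (Zq_expansion e2).
case: e1 e2 => [a1 ->] [a2 ->].
rewrite (@Zq_expansion _ ([seq (c * p.1, p.2) | p <- s1] ++ s2)).
  rewrite big_cat big_map mulr_sumr; congr (_ + _); apply: eq_bigr => p _ /=.
  by rewrite (laurent_eval_monoid q1).2 mulrA.
split; first by rewrite all_cat all_map a2 andbT.
rewrite big_cat big_map scaler_sumr; congr (_ + _).
by apply: eq_bigr => p _; rewrite scalerA.
Qed.

End ZqTheory.

(* Main.v *)
From HB Require Import structures.
From mathcomp Require Import all_boot all_order all_algebra.
From mathcomp Require Import finmap.
From mathcomp.multinomials Require Import monalg.
From mathcomp Require Import complex.
From mathcomp Require Import ring.
From mathcomp Require Import boolp classical_sets reals topology normedtype.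
From mathcomp Require Import sequences.
Require Import Defs.

(* Put x_m = q^m / [m], h = 1 - q, and let a act on sequences f : nat -> C as
   multiplication by x and b as the strict summation
   (B f)(m) = \sum_(n < m) f n; the letter a + h then acts as multiplication by
   1 / [m].  If delta_0 is the indicator of 0, then Z_q(w) is the sum over m of
   (w delta_0)(m).  The derivation (-1)^k (k+1) \partial_(k+1) acts as the
   commutator with an explicit lower triangular operator M_k, which kills
   delta_0, so Z_q of the derivative of w is, up to a factor, the sum of the
   sequence M_k (w delta_0).  This sum is 0 because the column sums of M_k
   vanish: the difference of two neighbouring columns telescopes, and the
   partial sums decay like a polynomial times q^N.  All the identities come from
   the addition law x_(i+j) (x_i + x_j + h) = x_i x_j. *)

Set Implicit Arguments.
Unset Strict Implicit.
Unset Printing Implicit Defensive.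

Import Order.TTheory GRing.Theory Num.Theory.
Import numFieldNormedType.Exports.

Local Open Scope ring_scope.

(** * The operators M_k *)

Section Kernel.
Variables (K : fieldType) (t : K) (x : nat -> K).
Hypothesis xD : forall i j, (0 < i)%N -> (0 < j)%N ->
  x (i + j)%N * (x i + x j + t) = x i * x j.

Definition sumlt (f : nat -> K) (m : nat) : K := \sum_(n < m) f n.
Definition mulx (f : nat -> K) (m : nat) : K := x m * f m.
Definition mulc (f : nat -> K) (m : nat) : K := (x m + t) * f m.
(** The action of [a(b+1) + hbar b]; that of [(b+1)a + hbar b] is [opu']. Powers of these two
    elements occur in the derivation. *)
Definition opu (f : nat -> K) (m : nat) : K := x m * f m + (x m + t) * sumlt f m.
Definition opu' (f : nat -> K) (m : nat) : K := x m * f m + sumlt (mulc f) m.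

(* For n < m, the coefficient of Y^k in
   (1 + t Y)^(m-n-1) / \prod_(n < j <= m) (1 - x_j Y), which is the (m, n) entry
   of opu^k \o mulc \o sumlt divided by x_m + t. *)
Fixpoint sg (k m n : nat) : K :=
  if k is k'.+1 then
    x m * sg k' m n + \sum_(n.+1 <= l < m) (x l + t) * sg k' l n
  else 1.

#[local] Arguments sg : simpl never.

Lemma sgS k m n :
  sg k.+1 m n = x m * sg k m n + \sum_(n.+1 <= l < m) (x l + t) * sg k l n.
Proof. by []. Qed.

Lemma sg_diag k n : sg k n.+1 n = x n.+1 ^+ k.
Proof.
elim: k => [|k IHk]; first by rewrite expr0.
by rewrite sgS big_geq // addr0 IHk exprS.
Qed.

Lemma sg_recl k m n : (n < m)%N ->
  sg k.+1 m.+1 n = x m.+1 * sg k m.+1 n + sg k.+1 m n + t * sg k m n.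
Proof. by move=> nm; rewrite !sgS big_nat_recr //=; ring. Qed.

(** Cancels the factor of index n+1 of the product, as [sg_recl] does at the other end. The
    definition of [sg] keeps n fixed, hence the induction on k. *)
Lemma sg_recr k m n : (n.+1 < m)%N ->
  sg k.+1 m n = x n.+1 * sg k m n + sg k.+1 m n.+1 + t * sg k m n.+1.
Proof.
elim: k m => [|k IHk] m nm.
  by rewrite !sgS big_ltn //=; ring.
have P1 := IHk _ nm.
have P2 := sgS k m n; rewrite big_ltn // sg_diag in P2.
have Q := sgS k m n.+1.
rewrite [LHS]sgS big_ltn // sg_diag [sg k.+2 m n.+1]sgS.
rewrite (eq_big_nat _ _ (F2 := fun l => x n.+1 * ((x l + t) * sg k l n) +
   ((x l + t) * sg k.+1 l n.+1 + t * ((x l + t) * sg k l n.+1)))); last first.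
  by move=> l /andP[nl _]; rewrite IHk //; ring.
rewrite !big_split -!mulr_sumr /= [in LHS]P1 P2 exprS.
by rewrite [X in _ = _ + t * X]Q; ring.
Qed.

(** With m = i+n+2, the generating functions of [sg] at (m, n), (m, n+1) and (m-1, n) are a common
    series times 1 + tY, 1 - x_(n+1) Y and 1 - x_m Y. The identity thus reduces to the addition law
    at i+1 and n+1. *)
Lemma sg_key k i n : x (i.+1 + n.+1)%N *
    (sg k (i.+1 + n.+1) n - sg k (i.+1 + n.+1) n.+1) =
  x i.+1 * (sg k (i + n.+1) n - sg k (i.+1 + n.+1) n.+1).
Proof.
have ni : (n < i + n.+1)%N by rewrite addnS ltnS leq_addl.
elim: k => [|k IHk]; first by rewrite /= !subrr !mulr0.
have r1 := sg_recl k ni; have r2 := sg_recr k (ni : (n.+1 < i.+1 + n.+1)%N).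
have xa := @xD i.+1 n.+1 isT isT.
rewrite addSn in IHk r2 xa *.
set X := x (i + n.+1).+1 in IHk r1 r2 xa *.
have -> : sg k.+1 (i + n.+1) n = sg k.+1 (i + n.+1).+1 n -
   X * sg k (i + n.+1).+1 n - t * sg k (i + n.+1) n by rewrite r1; ring.
rewrite r2; move: (sg k.+1 _ _) => R.
move: IHk; move: (sg k (i + n.+1) n) => s.
move: (sg k _ n) (sg k _ n.+1) => p r IHk.
have E : - t * (X * (p - r) - x i.+1 * (s - r)) = 0 by rewrite IHk subrr mulr0.
apply/eqP; rewrite -subr_eq0; apply/eqP; rewrite -E.
transitivity (- t * (X * (p - r) - x i.+1 * (s - r)) +
  p * (X * (x i.+1 + x n.+1 + t) - x i.+1 * x n.+1)).
  by ring.
by rewrite xa subrr mulr0 addr0.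
Qed.

(* Off the diagonal the entries are forced by the commutator with mulx; the
   diagonal is then forced by the commutator with sumlt. *)
Definition kerM (k m n : nat) : K :=
  if n == m then \sum_(1 <= j < m.+1) x j ^+ k.+1
  else (x m - x (m - n)%N) * sg k m n.

(** The matrix entries of [sumlt] after [opM k]; their decay in m is the vanishing of the column
    sums of M_k. *)
Definition colM k m n := \sum_(n <= l < m) kerM k l n.

Lemma kerM0 k m : kerM k m 0 = 0.
Proof.
rewrite /kerM; case: eqP => [<-|_]; first by rewrite big_geq.
by rewrite subn0 subrr mul0r.
Qed.

Lemma kerM_diag k m : kerM k m m = \sum_(1 <= j < m.+1) x j ^+ k.+1.
Proof. by rewrite /kerM eqxx. Qed.

Lemma kerM_off k i n :
  kerM k (i.+1 + n) n = (x (i.+1 + n)%N - x i.+1) * sg k (i.+1 + n) n.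
Proof. by rewrite /kerM addnK ifN // neq_ltn addSn ltnS leq_addl. Qed.

Lemma colM0 k m : colM k m 0 = 0.
Proof. by rewrite /colM big1 // => i _; rewrite kerM0. Qed.

Lemma colM_recr k m n : (n <= m)%N -> colM k m.+1 n = colM k m n + kerM k m n.
Proof. by move=> nm; rewrite /colM big_nat_recr. Qed.

(** When row i+n+2 is added, [sg_key] makes the difference of the two columns telescope. The base
    case needs diagonal entries differing by x_(n+1)^(k+1), whence the power sums in [kerM]. *)
Lemma colMS k i n : colM k (i.+1 + n.+1) n.+1 =
  colM k (i.+1 + n.+1) n + x i.+1 * sg k (i + n.+1) n.
Proof.
elim: i => [|i IHi].
  rewrite /colM !add1n big_nat1 big_nat_recr //= big_nat1 !kerM_diag.
  have := kerM_off k 0 n; rewrite !add1n => ->.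
  by rewrite add0n sg_diag big_nat_recr //= exprS; ring.

have le1 : (n.+1 <= i.+1 + n.+1)%N by rewrite leq_addl.
have D : kerM k (i.+1 + n.+1) n =
    (x (i.+1 + n.+1)%N - x i.+2) * sg k (i.+1 + n.+1) n.
  by rewrite addnS -addSn kerM_off.
rewrite [(i.+2 + _)%N]addSn 2?colM_recr ?(ltnW le1) // IHi kerM_off D.
have := sg_key k i n; move: (sg _ _ _) (sg _ _ _) (sg _ _ _) => s r p E.
apply/eqP; rewrite -subr_eq0; apply/eqP.
transitivity (x i.+1 * (s - r) - x (i.+1 + n.+1)%N * (p - r)); first by ring.
by rewrite E subrr.
Qed.

(** The entry (m, n) of [opM_mulc_sumlt]. Induction on m - n: passing to n+1 drops one term, and
    [colMS] with [sg_key] accounts for it. *)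
Lemma sum_kerM k m n : (n < m)%N ->
  \sum_(n.+1 <= l < m.+1) kerM k m l * (x l + t) =
  (x m + t) * colM k m n + x m * (x m + t) * sg k m n.
Proof.
move=> /subnKC; move: (m - _)%N => i; rewrite addnC => <-.
elim: i n => [|i IHi] n.
  rewrite !add0n /colM !big_nat1 sg_diag !kerM_diag big_nat_recr //= exprS.
  by ring.
rewrite big_ltn; last by rewrite ltnS (leq_addl i.+1 n.+1).
have := IHi n.+1; rewrite [(i + _)%N]addnS -addSn => ->.
rewrite kerM_off colMS.
have := sg_key k i n; have := @xD i.+1 n.+1 isT isT.
move: (sg _ _ _) (sg _ _ _) (sg _ _ _) (x _) (x _) (x _) => c b a w z X E1 E2.
apply/eqP; rewrite -subr_eq0; apply/eqP.
transitivity (- (X + t) * (X * (a - b) - z * (c - b)) +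
  b * (X * (z + w + t) - z * w)); first by ring.
by rewrite E1 E2 !subrr !mulr0 addr0.
Qed.

(** * Commutators of M_k with multiplication and summation *)

Definition opM k (f : nat -> K) (m : nat) : K := \sum_(n < m.+1) kerM k m n * f n.

Lemma sumlt_exch (F : nat -> nat -> K) m :
  \sum_(l < m) \sum_(n < l) F l n = \sum_(n < m) \sum_(n.+1 <= l < m) F l n.
Proof.
elim: m => [|m IHm]; first by rewrite !big_ord0.
rewrite !big_ord_recr /= IHm [in RHS]big_geq // addr0 -big_split /=.
by apply: eq_bigr => n _; rewrite big_nat_recr.
Qed.

Lemma iter_opu k f m : iter k opu (mulc (sumlt f)) m =
  (x m + t) * \sum_(n < m) sg k m n * f n.
Proof.
elim: k m => [|k IHk] m /=.
  by rewrite /mulc; congr (_ * _); apply: eq_bigr => n _; rewrite mul1r.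
have E : sumlt (iter k opu (mulc (sumlt f))) m =
    \sum_(n < m) \sum_(n.+1 <= l < m) (x l + t) * sg k l n * f n.
  rewrite -(sumlt_exch (fun l n => (x l + t) * sg k l n * f n)).
  apply: eq_bigr => l _; rewrite IHk mulr_sumr.
  by apply: eq_bigr => n _; rewrite mulrA.
rewrite {1}/opu IHk mulrCA E -mulrDr; congr (_ * _).
rewrite mulr_sumr -big_split /=.
by apply: eq_bigr => n _; rewrite sgS mulrDl mulrA mulr_suml.
Qed.

(** For 0 < n < m the addition law gives (x_m - x_(m-n)) (x_n - x_m) = - x_m (x_m + t); the diagonal
    contributes nothing. Column 0 vanishes on the left but need not on the right, hence the
    condition on f. *)
Lemma opM_mulx k f m : f 0%N = 0 ->
  opM k (mulx f) m - x m * opM k f m = - (x m * iter k opu (mulc (sumlt f)) m).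
Proof.
move=> f0; rewrite iter_opu /opM !big_ord_recr /= mulrDr !mulr_sumr /mulx.
rewrite opprD addrACA -!sumrB -sumrN.
have -> : kerM k m m * (x m * f m) - x m * (kerM k m m * f m) = 0 by ring.
rewrite addr0; apply: eq_bigr => -[[|n] /= nm] _.
  by rewrite f0 !mulr0 subrr oppr0.
have [i ->] : exists i, m = (i.+1 + n.+1)%N.
  by exists (m - n.+2)%N; rewrite addSnnS subnK.
rewrite kerM_off; have := @xD i.+1 n.+1 isT isT.
move: (sg _ _ _) (f _) (x _) (x _) (x _) => a b w z X E.
apply/eqP; rewrite -subr_eq0; apply/eqP.
transitivity (a * b * (X * (z + w + t) - z * w)); first by ring.
by rewrite E subrr mulr0.
Qed.

Lemma opM_mulc k f m : f 0%N = 0 ->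
  opM k (mulc f) m - (x m + t) * opM k f m =
  - (x m * iter k opu (mulc (sumlt f)) m).
Proof.
move=> f0; rewrite -opM_mulx // /opM !mulr_sumr -!sumrB.
by apply: eq_bigr => n _; rewrite /mulc /mulx; ring.
Qed.

Lemma sumlt_opM k f m : sumlt (opM k f) m = \sum_(n < m) colM k m n * f n.
Proof.
rewrite /sumlt; elim: m => [|m IHm]; first by rewrite !big_ord0.
rewrite big_ord_recr [in RHS]big_ord_recr /= IHm /opM big_ord_recr /= addrA.
rewrite (_ : colM k m.+1 m = kerM k m m); last by rewrite /colM big_nat1.
congr (_ + _); rewrite -big_split /=.
by apply: eq_bigr => n _; rewrite /colM big_nat_recr 1?ltnW // mulrDl.
Qed.

Lemma opM_mulc_sumlt k f m :
  opM k (mulc (sumlt f)) m - (x m + t) * sumlt (opM k f) m =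
  x m * iter k opu (mulc (sumlt f)) m.
Proof.
rewrite iter_opu sumlt_opM /opM.
transitivity (\sum_(n < m) \sum_(n.+1 <= l < m.+1) kerM k m l * (x l + t) * f n
  - (x m + t) * \sum_(n < m) colM k m n * f n).
  congr (_ - _); rewrite (eq_bigr (fun l : 'I_m.+1 =>
     \sum_(n < l) kerM k m l * (x l + t) * f n)); last first.
    by move=> l _; rewrite /mulc mulrA mulr_sumr.
  rewrite (sumlt_exch (fun l n => kerM k m l * (x l + t) * f n)).
  by rewrite big_ord_recr /= big_geq // addr0.
rewrite !mulr_sumr -sumrB; apply: eq_bigr => n _.
by rewrite -mulr_suml sum_kerM //; ring.
Qed.

(** Iterates (a + hbar)((b+1)a + hbar b) = (a(b+1) + hbar b)(a + hbar). *)
Lemma mulc_iter_opu' k f : mulc (iter k opu' f) = iter k opu (mulc f).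
Proof.
elim: k => //= k <-; apply: funext => m.
by rewrite /mulc /opu' /opu /mulc; ring.
Qed.

Hypothesis c_neq0 : forall m, x m + t != 0.

(** With c = [mulc] and B = [sumlt], the Leibniz rule gives c[M,B] = [M,cB] - [M,c]B, where both
    terms on the right are known; c is then cancelled. *)
Lemma opM_sumlt k f m : opM k (sumlt f) m - sumlt (opM k f) m =
  x m * iter k opu' (fun n => sumlt f n + sumlt (sumlt f) n) m.
Proof.
have sD : mulc (fun n => sumlt f n + sumlt (sumlt f) n) =
    (fun n => mulc (sumlt f) n + mulc (sumlt (sumlt f)) n).
  by apply: funext => n; rewrite /mulc mulrDr.
have itD g h : iter k opu (fun n => g n + h n) =
    (fun n => iter k opu g n + iter k opu h n).
  elim: k => //= j ->; apply: funext => n.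
  by rewrite /opu /sumlt big_split /=; ring.
apply: (mulfI (c_neq0 m)).
have := congr1 (@^~ m)
  (mulc_iter_opu' k (fun n => sumlt f n + sumlt (sumlt f) n)).
rewrite {1}/mulc mulrCA => ->; rewrite sD itD [RHS]mulrDr -opM_mulc_sumlt.
have sf0 : sumlt f 0 = 0 by rewrite /sumlt big_ord0.
by have /eqP := opM_mulc k m sf0; rewrite eq_sym eqr_oppLR => /eqP ->; ring.
Qed.

(** Iterates [colMS] from column 0, where [colM] vanishes. This form displays the decay in m. *)
Lemma colM_sum k m n : (n < m)%N ->
  colM k m n = \sum_(i < n) x (m - i.+1)%N * sg k m.-1 i.
Proof.
elim: n => [|n IHn] nm; first by rewrite big_ord0 colM0.
rewrite big_ord_recr /= -IHn 1?ltnW //.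
have [i ->] : exists i, m = (i.+1 + n.+1)%N.
  by exists (m - n.+2)%N; rewrite addSnnS subnK.
by rewrite colMS addnK.
Qed.

End Kernel.

(** * The action of the algebra on sequences *)

Section Action.
Variables (K : numFieldType) (t : K) (x : nat -> K).
Hypothesis t0 : t != 0.

Definition wact (u : seq bool) (f : nat -> K) : nat -> K :=
  foldr (fun (l : bool) g => if l then mulx x g else sumlt g) f u.

Definition Act (w : Halg) (f : nat -> K) (m : nat) : K :=
  \sum_(u <- msupp w) laurent_eval t w@_u * wact u f m.

Lemma Act_sumw (d : {fset word}) w f m : (msupp w `<=` d)%fset ->
  Act w f m = \sum_(u <- d) laurent_eval t w@_u * wact u f m.
Proof.
move=> le; rewrite /Act (big_fset_incl _ le) //= => u _ /mcoeff_outdom ->.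
by rewrite laurent_eval0 // mul0r.
Qed.

Lemma ActD w1 w2 f m : Act (w1 + w2) f m = Act w1 f m + Act w2 f m.
Proof.
rewrite (Act_sumw f m (msuppD_le w1 w2)) (Act_sumw f m (fsubsetUl _ (msupp w2))).
rewrite (Act_sumw f m (fsubsetUr (msupp w1) _)) -big_split /=.
by apply: eq_bigr => u _; rewrite mcoeffD laurent_evalD // mulrDl.
Qed.

Lemma ActZ c w f m : Act (c *: w) f m = laurent_eval t c * Act w f m.
Proof.
rewrite (Act_sumw f m (msuppZ_le c w)) mulr_sumr; apply: eq_bigr => u _.
by rewrite mcoeffZ (laurent_eval_monoid t0).2 mulrA.
Qed.

Lemma Act0 f m : Act 0 f m = 0.
Proof. by rewrite /Act msupp0 big_seq_fset0. Qed.

Lemma ActN w f m : Act (- w) f m = - Act w f m.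
Proof. by apply/eqP; rewrite -addr_eq0 -ActD addNr Act0. Qed.

Lemma Act_sum I (s : seq I) (F : I -> Halg) f m :
  Act (\sum_(i <- s) F i) f m = \sum_(i <- s) Act (F i) f m.
Proof.
exact: (big_morph (fun w => Act w f m) (fun u v => ActD u v f m) (Act0 f m)).
Qed.

Lemma ActU u f : Act << u >> f = wact u f.
Proof.
apply: funext => m; rewrite (Act_sumw f m msuppU_le) big_seq_fset1 mcoeffUU.
by rewrite (laurent_eval_monoid t0).1 mul1r.
Qed.

Lemma wact_sum u I (s : seq I) (c : I -> K) (g : I -> nat -> K) :
  wact u (fun m => \sum_(i <- s) c i * g i m) =
  (fun m => \sum_(i <- s) c i * wact u (g i) m).
Proof.
elim: u => [|[] u IHu] //=; rewrite IHu; apply: funext => m.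
  by rewrite /mulx mulr_sumr; apply: eq_bigr => i _; rewrite mulrCA.
by rewrite /sumlt exchange_big; apply: eq_bigr => i _; rewrite mulr_sumr.
Qed.

Lemma ActM w1 w2 f : Act (w1 * w2) f = Act w1 (Act w2 f).
Proof.
apply: funext => m; rewrite [in LHS](malg_wordE w1) mulr_suml Act_sum.
apply: eq_bigr => u _; rewrite -scalerAl ActZ; congr (_ * _).
rewrite {1}(malg_wordE w2) mulr_sumr Act_sum /Act wact_sum.
apply: eq_bigr => v _; rewrite -Halg_scaleAr -/(Act _ _ _) ActZ mulU ActU.
by congr (_ * _); rewrite /wact foldr_cat.
Qed.

Lemma wactB u f g :
  wact u (fun m => f m - g m) = (fun m => wact u f m - wact u g m).
Proof.
elim: u => [|[] u IHu] //=; rewrite IHu; apply: funext => m.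
  by rewrite /mulx mulrBr.
by rewrite /sumlt sumrB.
Qed.

Lemma ActB w f g m : Act w (fun n => f n - g n) m = Act w f m - Act w g m.
Proof.
by rewrite /Act -sumrB; apply: eq_bigr => u _; rewrite wactB mulrBr.
Qed.

Lemma Act1 f : Act 1 f = f.
Proof. exact: (ActU [::]). Qed.

Lemma ActX w k f : Act (w ^+ k) f = iter k (Act w) f.
Proof. by elim: k => [|k IHk]; rewrite ?expr0 ?Act1 // exprS ActM IHk. Qed.

Lemma Act_a f : Act gen_a f = mulx x f.
Proof. exact: ActU. Qed.

Lemma Act_b f : Act gen_b f = sumlt f.
Proof. exact: ActU. Qed.

Lemma Act_c f : Act (gen_a + hbar%:A) f = mulc t x f.
Proof.
apply: funext => m; rewrite ActD ActZ Act_a Act1 laurent_eval_hbar //.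
by rewrite /mulx /mulc mulrDl.
Qed.

Lemma Act_u f : Act (gen_a * (gen_b + 1) + hbar *: gen_b) f = opu t x f.
Proof.
apply: funext => m; rewrite ActD ActZ ActM Act_a /mulx ActD Act_b Act1.
by rewrite laurent_eval_hbar // /opu; ring.
Qed.

Lemma Act_u' f : Act ((gen_b + 1) * gen_a + hbar *: gen_b) f = opu' t x f.
Proof.
apply: funext => m; rewrite ActD ActZ ActM ActD Act_a Act_b Act1 Act_b.
rewrite laurent_eval_hbar // /opu' /sumlt mulr_sumr addrAC -big_split addrC.
by congr (_ + _); apply: eq_bigr => n _; rewrite /mulx /mulc mulrDl.
Qed.

(* (-1)^k (k + 1) \partial_(k + 1). *)
Definition derK k : Halg -> Halg := derH
  (- (gen_a * (gen_a * (gen_b + 1) + hbar *: gen_b) ^+ k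
        * (gen_a + hbar%:A) * gen_b))
  (gen_a * ((gen_b + 1) * gen_a + hbar *: gen_b) ^+ k * (gen_b + 1) * gen_b).

Hypothesis xD : forall i j, (0 < i)%N -> (0 < j)%N ->
  x (i + j)%N * (x i + x j + t) = x i * x j.
Hypothesis c_neq0 : forall m, x m + t != 0.

Definition Act_comm k w f :=
  Act (derK k w) f = (fun m => opM t x k (Act w f) m - Act w (opM t x k f) m).

Lemma Act_comm_a k f : f 0%N = 0 -> Act_comm k gen_a f.
Proof.
move=> f0; apply: funext => m; rewrite /derK derH_a ActN !ActM !Act_a /mulx.
rewrite ActX Act_b Act_c.
have -> : iter k (Act (gen_a * (gen_b + 1) + hbar *: gen_b)) = iter k (opu t x).
  by apply: funext; apply: eq_iter; exact: Act_u.
by rewrite -(opM_mulx xD).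
Qed.

Lemma Act_comm_b k f : Act_comm k gen_b f.
Proof.
apply: funext => m; rewrite /derK derH_b !ActM !Act_b Act_a /mulx ActX.
have -> : iter k (Act ((gen_b + 1) * gen_a + hbar *: gen_b)) = iter k (opu' t x).
  by apply: funext; apply: eq_iter; exact: Act_u'.
have -> : Act (gen_b + 1) (sumlt f) = (fun n => sumlt f n + sumlt (sumlt f) n).
  by apply: funext => n; rewrite ActD Act1 Act_b addrC.
by rewrite -(opM_sumlt xD).
Qed.

Lemma Act_comm1 k f : Act_comm k 1 f.
Proof.
have d1 : derK k 1 = 0 by exact: (derHU _ _ [::]).
by apply: funext => m; rewrite d1 Act0 !Act1 subrr.
Qed.

(** Derivations and commutators obey the same Leibniz rule; the two middle terms cancel. *)
Lemma Act_comm_mul k w1 w2 f :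
  Act_comm k w2 f -> Act_comm k w1 (Act w2 f) -> Act_comm k (w1 * w2) f.
Proof.
move=> c2 c1; apply: funext => m.
have -> : derK k (w1 * w2) = derK k w1 * w2 + w1 * derK k w2 by exact: derHM.
rewrite ActD !ActM c1 c2 ActB addrA subrK //.
Qed.

Lemma Act_comm_aX k j f : f 0%N = 0 -> Act_comm k (gen_a ^+ j) f.
Proof.
elim: j f => [|j IHj] f f0; first exact: Act_comm1.
rewrite exprSr; apply: Act_comm_mul; first exact: Act_comm_a.
by apply: IHj; rewrite Act_a /mulx f0 mulr0.
Qed.

(** The derivation kills constants, and [mulc] has the same commutator as [mulx]. *)
Lemma Act_comm_c k f : f 0%N = 0 -> Act_comm k (gen_a + hbar%:A) f.
Proof.
move=> f0; have -> : Act_comm k (gen_a + hbar%:A) f = (Act (derK k gen_a) f =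
    (fun m => opM t x k (mulc t x f) m - mulc t x (opM t x k f) m)).
  rewrite /Act_comm !Act_c.
  have -> : derK k (gen_a + hbar%:A) = derK k gen_a + hbar *: derK k 1.
    by rewrite -derHZ -derHD.
  have -> : derK k 1 = 0 by exact: (derHU _ _ [::]).
  by rewrite scaler0 addr0.
rewrite Act_comm_a //; apply: funext => m.
by rewrite !Act_a; exact: etrans (opM_mulx xD _ _ f0) (esym (opM_mulc xD _ _ f0)).
Qed.

(** Every e_i ends in b, and [sumlt] produces sequences vanishing at 0, so the condition attached to
    the letter a is met for arbitrary f. *)
Lemma Act_comm_eNhat k i f : Act_comm k (eNhat i) f.
Proof.
have sf0 : Act gen_b f 0%N = 0 by rewrite Act_b /sumlt big_ord0.
case: i => [|i i0] /=; apply: Act_comm_mul; try exact: Act_comm_b.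
  exact: Act_comm_a.
apply: Act_comm_mul; first exact: Act_comm_c.
by apply: Act_comm_aX; rewrite Act_c /mulc sf0 mulr0.
Qed.

Lemma Act_comm_eindex k ks f : Act_comm k (eindex ks) f.
Proof.
rewrite /eindex; elim: ks => [|i ks IHks].
  by rewrite big_nil; exact: Act_comm1.
by rewrite big_cons; apply: Act_comm_mul => //; exact: Act_comm_eNhat.
Qed.

Definition delta0 (m : nat) : K := (m == 0%N)%:R.

Lemma Act_derK_eindex k ks :
  Act (derK k (eindex ks)) delta0 = opM t x k (Act (eindex ks) delta0).
Proof.
(* Column 0 of [kerM] is zero. The zero sequence is written as a difference so that [ActB] applies
   to it. *)
have M0 : opM t x k delta0 = (fun n => delta0 n - delta0 n).
  apply: funext => m; rewrite subrr /opM big_ord_recl kerM0 mul0r add0r.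
  by rewrite big1 // => n _; rewrite /delta0 mulr0.
rewrite Act_comm_eindex; apply: funext => m.
by rewrite M0 ActB subrr subr0.
Qed.

End Action.

(** * The span of the admissible indices *)

(** For [P := admissible] this unfolds to [H0hat]; other predicates serve the induction over
    words. *)
Definition espan (P : pred (seq Nhat)) (w : Halg) : Prop :=
  exists s : seq (laurent * seq Nhat),
    all (fun p => P p.2) s /\ w = \sum_(p <- s) p.1 *: eindex p.2.

Section Span.
Variable P : pred (seq Nhat).

Lemma espan0 : espan P 0.
Proof. by exists [::]; rewrite big_nil. Qed.

Lemma espanD w1 w2 : espan P w1 -> espan P w2 -> espan P (w1 + w2).
Proof.
move=> [s1 [a1 ->]] [s2 [a2 ->]]; exists (s1 ++ s2).
by rewrite all_cat a1 a2 big_cat.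
Qed.

Lemma espanZ c w : espan P w -> espan P (c *: w).
Proof.
move=> [s [a ->]]; exists [seq (c * p.1, p.2) | p <- s]; rewrite all_map.
split=> //; rewrite big_map scaler_sumr.
by apply: eq_bigr => p _; rewrite scalerA.
Qed.

Lemma espan_sum I (s : seq I) (Q : pred I) (F : I -> Halg) :
  (forall i, Q i -> espan P (F i)) -> espan P (\sum_(i <- s | Q i) F i).
Proof. by move=> h; apply: big_ind => //; [exact: espan0|exact: espanD]. Qed.

Lemma espan_eindex ks : P ks -> espan P (eindex ks).
Proof. by move=> Pk; exists [:: (1, ks)]; rewrite /= Pk big_seq1 scale1r. Qed.

End Span.

Lemma espan_map (P Q : pred (seq Nhat)) (F : Halg -> Halg) : linear F ->
  (forall ks, P ks -> espan Q (F (eindex ks))) ->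
  forall w, espan P w -> espan Q (F w).
Proof.
move=> linF h w [s [a ->]]; elim: s a => [_|p s IHs /= /andP[Pp Ps]].
  have F0 : F 0 = 0.
    by have := linF (-1) 0 0; rewrite scaler0 addr0 scaleN1r addNr.
  by rewrite big_nil F0; exact: espan0.
rewrite big_cons linF; apply: espanD; last exact: IHs.
by apply: espanZ; exact: h.
Qed.

Lemma linear_mulr (y : Halg) : linear ( *%R y).
Proof. by move=> c u v; rewrite mulrDr Halg_scaleAr. Qed.

Fact hbarV_subproof : 1 / FracField.tofrac 'X ^+ 1 \in is_laurent.
Proof. by apply/asboolP; exists 1%N, 1; rewrite tofrac1. Qed.

Definition hbarV : laurent := Laurent hbarV_subproof.

Lemma hbarVM : hbarV * hbar = 1.
Proof.
apply: val_inj; rewrite -[LHS]/(laurent_val hbarV * laurent_val hbar) /=.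
by rewrite expr1 mul1r mulVf // -(expr1 (FracField.tofrac _)) Xfrac_neq0.
Qed.

Definition nonempty (ks : seq Nhat) := (0 < size ks)%N.

Lemma eindex_cons k ks : eindex (k :: ks) = eNhat k * eindex ks.
Proof. by rewrite /eindex big_cons. Qed.

(** Since e_1 - ab = hbar b, inverting hbar expresses b through e_1 and ab. *)
Lemma espan_b ks : espan nonempty (gen_b * eindex ks).
Proof.
have -> : gen_b = hbarV *: (eNhat (@Num 1 isT) + (- 1) *: eNhat Bar1).
  rewrite /= expr0 mul1r mulrDl addrAC scaleN1r subrr add0r -scalerAl mul1r.
  by rewrite scalerA hbarVM scale1r.
rewrite -scalerAl mulrDl -scalerAl -!eindex_cons.
by apply/espanZ/espanD; [|apply: espanZ]; exact: espan_eindex.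
Qed.

(** Multiplication by a turns e_k into e_(k+1), and ab into e_2 - hbar ab; no leading entry 1
    appears. *)
Lemma espan_a ks : nonempty ks ->
  espan (fun ks => nonempty ks && admissible ks) (gen_a * eindex ks).
Proof.
case: ks => // -[|[//|k] k0] ks _; rewrite eindex_cons mulrA.
  have -> : gen_a * eNhat Bar1 = eNhat (@Num 2 isT) + (- hbar) *: eNhat Bar1.
    rewrite /= expr1 mulrDr mulrDl -Halg_scaleAr mulr1 -scalerAl scaleNr.
    by rewrite addrK mulrA.
  rewrite mulrDl -scalerAl -!eindex_cons.
  by apply: espanD; [|apply: espanZ]; exact: espan_eindex.
have -> : gen_a * eNhat (Num k0) = eNhat (@Num k.+2 isT).
  by rewrite /= !mulrA -exprS.
by rewrite -eindex_cons; exact: espan_eindex.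
Qed.

Lemma espan_sub (P Q : pred (seq Nhat)) w : (forall ks, P ks -> Q ks) ->
  espan P w -> espan Q w.
Proof.
by move=> PQ [s [a e]]; exists s; split=> //; apply: sub_all a => p; exact: PQ.
Qed.

Lemma espan_mulb (y : Halg) : espan nonempty (y * gen_b).
Proof.
rewrite (malg_wordE y) mulr_suml; apply: espan_sum => u _.
rewrite -scalerAl; apply: espanZ; elim: u => [|l u IHu].
  have := espan_b [::]; rewrite /eindex big_nil mulr1.
  by rewrite (_ : << _ >> = 1) // mul1r.
have -> : << (l :: u : word) >> =
    << ([:: l] : word) >> * << (u : word) >> :> Halg.
  by rewrite mulU.
rewrite -mulrA; case: l.
  apply: (espan_map (linear_mulr gen_a)) IHu => ks /espan_a.
  by apply: espan_sub => ? /andP[].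
by apply: (espan_map (linear_mulr gen_b)) IHu => ks _; exact: espan_b.
Qed.

(** With [eindex_amulb], this describes [H0hat] as the constants plus aHb, a form in which stability
    under the derivation is visible. *)
Lemma H0hat_amulb (y : Halg) : H0hat (gen_a * y * gen_b).
Proof.
rewrite -mulrA.
apply: (espan_map (linear_mulr gen_a) _ (espan_mulb y)) => ks /espan_a.
by apply: espan_sub => ? /andP[].
Qed.

Lemma eindex_mulb k ks : exists y, eindex (k :: ks) = y * gen_b.
Proof.
elim: ks k => [|j ks IHks] k.
  by rewrite /eindex big_seq1; case: k => [|k k0] /=; eexists.
by have [y e] := IHks j; exists (eNhat k * y); rewrite eindex_cons e mulrA.
Qed.

Lemma eNhat_amul k : admissible [:: k] -> exists y, eNhat k = gen_a * y * gen_b.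
Proof.
case: k => [_|[//|[//|k]] k0 _]; first by exists 1; rewrite mulr1.
by exists (gen_a ^+ k * (gen_a + hbar%:A)); rewrite /= exprS !mulrA.
Qed.

Lemma mulA_inner (S : pzRingType) (a y b z : S) :
  a * y * b * (z * b) = a * (y * b * z) * b.
Proof. by rewrite !mulrA. Qed.

Lemma leibniz_inner (S : pzRingType) (a x d y w b : S) :
  (a * x * w + a * d) * b + a * w * (y * b) = a * (x * w + d + w * y) * b.
Proof. by rewrite !mulrDr !mulrDl !mulrA. Qed.

Lemma eindex_amulb k ks : admissible (k :: ks) ->
  exists y, eindex (k :: ks) = gen_a * y * gen_b.
Proof.
move=> adm; have [y e] := @eNhat_amul k adm; rewrite eindex_cons e.
case: ks {adm} => [|j ks]; first by exists y; rewrite /eindex big_nil mulr1.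
have [z ->] := eindex_mulb j ks.
by exists (y * gen_b * z); exact: mulA_inner.
Qed.

Lemma derHZZ (x y : Halg) c w : derH (c *: x) (c *: y) w = c *: derH x y w.
Proof.
rewrite /derH scaler_sumr; apply: eq_bigr => u _.
rewrite scalerA mulrC -scalerA; congr (_ *: _).
elim: u => [|l u IHu] /=; first by rewrite scaler0.
by rewrite IHu scalerDr -Halg_scaleAr; congr (_ + _); case: l; rewrite scalerAl.
Qed.

Lemma mulrN_outer (S : pzRingType) (a x y b : S) :
  - (a * x * y * b) = a * - (x * y * b).
Proof. by rewrite mulrN !mulrA. Qed.

(** Every Leibniz term of a w b still starts with a, since the image of a does, and still ends in b,
    since the image of b does. *)
Lemma derH_amulb (x y z w : Halg) : exists v,
  derH (- (gen_a * x * y * gen_b)) (z * gen_b) (gen_a * w * gen_b) =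
  gen_a * v * gen_b.
Proof.
rewrite mulrN_outer; move: (- _) => p.
exists (p * w + derH (gen_a * p) (z * gen_b) w + w * z).
by rewrite 2!derHM derH_a derH_b leibniz_inner.
Qed.

Lemma derHZN (x y : Halg) c w :
  derH ((- c) *: x) (c *: y) w = c *: derH (- x) y w.
Proof. by rewrite -derHZZ scalerN scaleNr. Qed.

Lemma laurentCN r : laurentC (- r) = - laurentC r.
Proof.
by apply: val_inj; rewrite -[RHS]/(- laurent_val (laurentC r)) /= polyCN tofracN.
Qed.

Lemma partialHE n w : (0 < n)%N ->
  partialH n w = laurentC ((-1) ^+ n.-1 / n%:R) *: derK n.-1 w.
Proof.
case: n => // n _.
have e : (-1) ^+ n.+1 / n.+1%:R = - ((-1) ^+ n / n.+1%:R) :> rat.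
  by rewrite exprS mulN1r mulNr.
by rewrite /partialH e laurentCN; exact: derHZN.
Qed.

Lemma H0hat_derK k w : H0hat w -> H0hat (derK k w).
Proof.
apply: espan_map; first exact: derH_is_linear.
move=> [_|i ks adm].
  have -> : derK k (eindex [::]) = 0.
    by rewrite /eindex big_nil; exact: (derHU _ _ [::]).
  exact: espan0.
have [y ->] := eindex_amulb adm.
have [v ->] : exists v, derK k (gen_a * y * gen_b) = gen_a * v * gen_b.
  exact: derH_amulb.
exact: H0hat_amulb.
Qed.

(** * Truncated sums *)

Lemma big_tuple_cons (V : nmodType) (T : finType) n (P : pred (n.+1.-tuple T))
    (F : n.+1.-tuple T -> V) :
  \sum_(u | P u) F u =
  \sum_i \sum_(u : n.-tuple T | P [tuple of i :: u]) F [tuple of i :: u].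
Proof.
rewrite pair_big_dep /=.
rewrite (reindex (fun p : T * n.-tuple T => [tuple of p.1 :: p.2])) //=.
exists (fun u : n.+1.-tuple T => (thead u, [tuple of behead u]))
  => [[i u] _|u _] /=.
  by rewrite theadE; congr (_, _); apply: val_inj.
by rewrite [RHS]tuple_eta.
Qed.

Section ZetaTrunc.
Variables (R : realType) (q : Cplx R).
Hypothesis hq : `|q| < 1.

Lemma qX_neq1 m : (0 < m)%N -> 1 - q ^+ m != 0.
Proof.
move=> m0; have: `|q ^+ m| < 1 by rewrite normrX exprn_ilt1 // -lt0n.
by rewrite subr_eq0; apply: contraTneq => <-; rewrite normr1 ltxx.
Qed.

Lemma subq_neq0 : 1 - q != 0.
Proof. by have := qX_neq1 (ltn0Sn 0); rewrite expr1. Qed.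

Lemma qint_neq0 m : (0 < m)%N -> qint q m != 0.
Proof. by move=> m0; rewrite mulf_neq0 ?invr_eq0 ?subq_neq0 // qX_neq1. Qed.

Definition xq (m : nat) : Cplx R := q ^+ m / qint q m.

(* Junk value: [0] = 0, so q^0 / [0] = 0. *)
Lemma xq0 : xq 0 = 0.
Proof. by rewrite /xq /qint expr0 subrr mul0r invr0 mulr0. Qed.

Lemma xqD_inv m : (0 < m)%N -> xq m + (1 - q) = (qint q m)^-1.
Proof.
by move=> m0; rewrite /xq /qint; field; rewrite qX_neq1 // subq_neq0.
Qed.

(** For q nonzero this says that 1 + (1-q)/x_m = q^(-m) is multiplicative in m. *)
Lemma xqD i j : (0 < i)%N -> (0 < j)%N ->
  xq (i + j) * (xq i + xq j + (1 - q)) = xq i * xq j.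
Proof.
move=> i0 j0; have ij0 : (0 < i + j)%N by rewrite addn_gt0 i0.
have := qX_neq1 ij0; rewrite /xq /qint exprD => ij1.
by field; rewrite ij1 !qX_neq1 // subq_neq0.
Qed.

Lemma xqc_neq0 m : xq m + (1 - q) != 0.
Proof.
case: m => [|m]; first by rewrite xq0 add0r subq_neq0.
by rewrite xqD_inv // invr_eq0 qint_neq0.
Qed.

(** The multiplier applied after [sumlt] in the action of e_k. It can differ from [Fq] at m = 0: for
    k = 1 it is 1 - q there, while [Fq] takes the default value 0. *)
Definition Fx (k : Nhat) (m : nat) : Cplx R :=
  if k is @Num j _ then xq m ^+ j.-1 * (xq m + (1 - q)) else xq m.

Lemma FqE k m : (0 < m)%N -> Fq q k m = Fx k m.
Proof.
case: k => [|[//|k] k0] // m0; rewrite /Fx xqD_inv //= /xq.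
rewrite [(q ^+ m / qint q m) ^+ _]exprMn exprVn -exprM mulnC.
by rewrite [qint q m ^+ k.+1]exprSr invfM mulrA.
Qed.

Local Notation act := (Act (1 - q) xq).
Local Notation act_e ks := (act (eindex ks) (delta0 _)).

Lemma act_eNhat k f m : act (eNhat k) f m = Fx k m * sumlt f m.
Proof.
have h0 := subq_neq0; case: k => [|k k0] /=.
  by rewrite ActM // Act_a // Act_b.
rewrite !ActM // ActX // Act_b // Act_c //.
have -> : iter k.-1 (act gen_a) = iter k.-1 (mulx xq).
  by apply: funext; apply: eq_iter => g; exact: Act_a.
elim: k.-1 => [|j IHj]; first by rewrite mul1r.
by rewrite iterS /mulx -/(mulx xq) IHj exprS !mulrA.
Qed.

(* zeta_trunc with the largest summation index below M. *)
Definition zt (ks : seq Nhat) (M N : nat) : Cplx R :=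
  \sum_(m : (size ks).-tuple 'I_N.+1
        | path gtn M [seq val i | i <- m] && all (fun i : 'I_N.+1 => 0 < i)%N m)
    \prod_(j < size ks) Fq q (tnth (in_tuple ks) j) (tnth m j).

Lemma zt_cons k ks M N : zt (k :: ks) M N =
  \sum_(i < N.+1 | (0 < i < M)%N) Fq q k i * zt ks i N.
Proof.
rewrite /zt big_tuple_cons [RHS]big_mkcond; apply: eq_bigr => i _ /=.
case: ifP => [/andP[i0 iM]|iM]; last first.
  apply: big_pred0 => u; apply: contraFF iM.
  by move=> /andP[/andP[-> _] /andP[-> _]].
rewrite mulr_sumr; apply: eq_big => [u|u _]; first by rewrite iM i0.
rewrite big_ord_recl; apply: congr2; first by rewrite tnth0.
by apply: eq_bigr => j _; rewrite tnthS; congr (Fq _ _ _); rewrite !(tnth_nth k).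
Qed.

(** delta_0 acts as a last summation index equal to 0, so strict descent forces the others to be
    positive. *)
Lemma ztE ks M N : (0 < M <= N.+1)%N -> zt ks M N = sumlt (act_e ks) M.
Proof.
elim: ks M => [|k ks IHks] M /andP[M0 MN].
  rewrite /zt (big_pred1 [tuple]) => [|u]; last by rewrite tuple0.
  rewrite big_ord0; case: M M0 {MN} => // M _.
  rewrite /eindex big_nil Act1 ?subq_neq0 // /sumlt big_ord_recl.
  by rewrite big1 ?addr0 // => i _; rewrite /delta0.
rewrite zt_cons; transitivity (\sum_(i < M | (0 < i)%N) Fq q k i * zt ks i N).
  by rewrite (big_ord_widen_cond _ (fun i => (0 < i)%N)
       (fun i => Fq q k i * zt ks i N) MN).
rewrite /sumlt [LHS]big_mkcond; apply: eq_bigr => i _.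
rewrite eindex_cons ActM ?subq_neq0 // act_eNhat.
(* At i = 0 the inner sum is empty, which matches the exclusion of 0 in [zt]. *)
case: ifP => [i0|/negbT]; last first.
  by rewrite -eqn0Ngt => /eqP ->; rewrite /sumlt big_ord0 mulr0.
by rewrite FqE // IHks // i0 (leq_trans (ltnW (ltn_ord i)) MN).
Qed.

Lemma zeta_truncE ks N : zeta_trunc q ks N = sumlt (act_e ks) N.+1.
Proof.
rewrite -(@ztE _ _ N) ?leqnn //; apply: eq_bigl => -[[|i u] su] //=.
by rewrite /= ltn_ord.
Qed.

End ZetaTrunc.

(** * Growth and convergence *)

Section Bounds.
Variable K : numClosedFieldType.
Implicit Types (f g : nat -> K) (r C : K).

Definition polybd_geo r f := exists C p, 0 <= C /\
  forall m, `|f m| <= C * m.+1%:R ^+ p * r ^+ m.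

Definition polybd f := exists C p, 0 <= C /\ forall m, `|f m| <= C * m.+1%:R ^+ p.

Lemma natrX_le (m n p : nat) : (m <= n)%N -> m%:R ^+ p <= n%:R ^+ p :> K.
Proof. by move=> mn; apply: lerXn2r; rewrite ?nnegrE ?ler_nat. Qed.

Lemma norm_sum_le f (a b m : nat) C : 0 <= C -> (b - a <= m)%N ->
  (forall l, (a <= l < b)%N -> `|f l| <= C) ->
  `|\sum_(a <= l < b) f l| <= m%:R * C.
Proof.
move=> C0 abm h; apply: (le_trans (ler_norm_sum _ _ _)).
rewrite big_nat_cond.
apply: (@le_trans _ _ (\sum_(a <= l < b | (a <= l < b)%N && true) C)).
  by apply: ler_sum => l /andP[/h].
by rewrite -big_nat_cond sumr_const_nat -[leLHS]mulr_natl ler_wpM2r // ler_nat.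
Qed.

Lemma polybd_sumlt f : polybd f -> polybd (sumlt f).
Proof.
move=> [C [p [C0 h]]]; exists C, p.+1; split=> // m.
have B0 : 0 <= C * m.+1%:R ^+ p by rewrite mulr_ge0 // exprn_ge0.
rewrite /sumlt -(big_mkord xpredT f) exprSr mulrA mulrC.
apply: (@le_trans _ _ (m%:R * (C * m.+1%:R ^+ p))).
  apply: norm_sum_le; rewrite ?subn0 // => l /andP[_ lm].
  by apply: le_trans (h l) _; rewrite ler_wpM2l // natrX_le // ltnW.
by rewrite ler_wpM2r // ler_nat.
Qed.

(** With s the (p+1)-th root of r, (m+1) s^m <= 1 + s + ... + s^m <= 1/(1-s); raise this to the
    power p+1. *)
Lemma natrX_geo_le r p : 0 <= r -> r < 1 ->
  exists2 C, 0 <= C & forall m, m.+1%:R ^+ p.+1 * r ^+ m <= C.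
Proof.
move=> r0 r1; pose s := p.+1.-root r.
have s0 : 0 <= s by rewrite rootC_ge0.
have s1 : s < 1 by rewrite rootC_lt1.
have d0 : 0 < 1 - s by rewrite subr_gt0.
exists ((1 - s)^-1 ^+ p.+1); first by rewrite exprn_ge0 // invr_ge0 ltW.
move=> m; have <- : s ^+ p.+1 = r by rewrite rootCK.
rewrite exprAC -exprMn; apply: lerXn2r;
  rewrite ?nnegrE ?mulr_ge0 ?exprn_ge0 ?invr_ge0 ?(ltW d0) //.
rewrite -[leRHS]mul1r ler_pdivlMr //.
apply: (@le_trans _ _ ((1 - s) * \sum_(i < m.+1) s ^+ i)).
  rewrite mulrC ler_wpM2l ?(ltW d0) // mulr_natl.
  rewrite -[m.+1 in leLHS]card_ord -sumr_const.
  by apply: ler_sum => i _; rewrite ler_wiXn2l ?(ltW s1) // -ltnS.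
by rewrite -[1 - s]opprB mulNr -subrX1 opprB gerBl exprn_ge0.
Qed.

Lemma polybd_geo_le r f : 0 <= r -> r < 1 -> polybd_geo r f ->
  exists C s, [/\ 0 <= C, 0 <= s, s < 1 & forall m, `|f m| <= C * s ^+ m].
Proof.
move=> r0 r1 [C [p [C0 h]]].
(* The midpoint s of r and 1 is positive even for r = 0, and (r/s)^m absorbs the polynomial
   factor. *)
have s0 : 0 < (1 + r) / 2 by rewrite divr_gt0 // ltr_wpDr.
have s1 : (1 + r) / 2 < 1 by rewrite ltr_pdivrMr // mul1r mulr2n ltrD2l.
have rs : r < (1 + r) / 2 by rewrite ltr_pdivlMr // mulrC mulr_natl mulr2n ltrD2r.
move: (_ / 2) s0 s1 rs => s s0 s1 rs.
have [||D D0 hD] := @natrX_geo_le (r / s) p; first by rewrite divr_ge0 // ltW.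
  by rewrite ltr_pdivrMr // mul1r.
exists (C * D), s; rewrite mulr_ge0 // (ltW s0); split=> // m.
apply: le_trans (h m) _; rewrite -!mulrA ler_wpM2l //.
have -> : r ^+ m = (r / s) ^+ m * s ^+ m by rewrite -exprMn divfK // gt_eqF.
rewrite mulrA ler_wpM2r ?exprn_ge0 ?(ltW s0) //; apply: le_trans (hD m).
rewrite ler_wpM2r ?exprn_ge0 ?divr_ge0 ?(ltW s0) // exprS ler_peMl ?exprn_ge0 //.
by rewrite ler1n.
Qed.

(** * Estimates for the operators M_k *)

Section Operators.
Variables (t : K) (x : nat -> K) (X r : K).
Hypothesis xD : forall i j, (0 < i)%N -> (0 < j)%N ->
  x (i + j)%N * (x i + x j + t) = x i * x j.
Hypotheses (r0 : 0 <= r) (r1 : r < 1) (X0 : 0 <= X).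
Hypothesis xX : forall m, `|x m| <= X * r ^+ m.

Lemma x_le m : `|x m| <= X.
Proof.
by apply: le_trans (xX m) _; rewrite ler_piMr // exprn_ile1 // ltW.
Qed.

Lemma xt_le m : `|x m + t| <= X + `|t|.
Proof. by apply: le_trans (ler_normD _ _) _; rewrite lerD2r x_le. Qed.

Lemma sg_le k : exists C p, 0 <= C /\
  forall m n, `|sg t x k m n| <= C * m.+1%:R ^+ p.
Proof.
elim: k => [|k [C [p [C0 h]]]].
  by exists 1, 0%N; split=> // m n; rewrite /= normr1 expr0 mul1r.
have Y0 : 0 <= X + `|t| by rewrite addr_ge0.
exists ((X + `|t|) * C), p.+1; split=> [|m n]; first exact: mulr_ge0.
set B := (X + `|t|) * C * m.+1%:R ^+ p.
have B0 : 0 <= B by rewrite !mulr_ge0 ?exprn_ge0 //.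
have -> : (X + `|t|) * C * m.+1%:R ^+ p.+1 = m.+1%:R * B.
  by rewrite /B exprS; ring.
rewrite -natr1 mulrDl mul1r [leRHS]addrC.
apply: le_trans (ler_normD _ _) _; apply: lerD.
  rewrite normrM /B -mulrA ler_pM //; apply: le_trans (x_le m) _.
  by rewrite lerDl.
apply: norm_sum_le; rewrite ?leq_subr // => l /andP[_ lm].
rewrite normrM /B -mulrA ler_pM ?xt_le //; apply: le_trans (h l n) _.
by rewrite ler_wpM2l // natrX_le // ltnW.
Qed.

Lemma polybd_geo_mulx f : polybd f -> polybd_geo r (mulx x f).
Proof.
move=> [C [p [C0 h]]]; exists (X * C), p; split=> [|m]; first exact: mulr_ge0.
have -> : X * C * m.+1%:R ^+ p * r ^+ m = X * r ^+ m * (C * m.+1%:R ^+ p) by ring.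
by rewrite normrM ler_pM.
Qed.

(** In [colM_sum] the factor x_(m-i-1) with i < n and the decay r^n of f combine to at most r^m. The
    two nested sums have at most m terms each and cost two powers of m+1. *)
Lemma polybd_geo_sumlt_opM k f :
  polybd_geo r f -> polybd_geo r (sumlt (opM t x k f)).
Proof.
move=> [C [p [C0 h]]]; have [D [d [D0 hD]]] := sg_le k.
exists (X * D * C), (d + p).+2; split=> [|m]; first by rewrite !mulr_ge0.
set B := X * D * C * m.+1%:R ^+ (d + p) * r ^+ m.
have B0 : 0 <= B by rewrite !mulr_ge0 ?exprn_ge0 //.
have -> : X * D * C * m.+1%:R ^+ (d + p).+2 * r ^+ m = m.+1%:R * (m.+1%:R * B).
  by rewrite /B !exprS; ring.
have mB : m%:R * B <= m.+1%:R * B by rewrite ler_wpM2r // ler_nat.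
rewrite sumlt_opM -(big_mkord xpredT (fun n => colM t x k m n * f n)).
apply: (@le_trans _ _ (m%:R * (m.+1%:R * B))); last first.
  by rewrite ler_wpM2r ?ler_nat // mulr_ge0.
apply: norm_sum_le; rewrite ?subn0 1?mulr_ge0 // => n /andP[_ nm].
apply: le_trans mB; rewrite colM_sum // mulr_suml.
rewrite -(big_mkord xpredT (fun i => x (m - i.+1)%N * sg t x k m.-1 i * f n)).
apply: norm_sum_le; rewrite ?subn0 ?(ltnW nm) // => i /andP[_ im].
rewrite !normrM /B exprD.
have -> : X * D * C * (m.+1%:R ^+ d * m.+1%:R ^+ p) * r ^+ m =
  X * (D * m.+1%:R ^+ d) * (C * m.+1%:R ^+ p) * r ^+ m by ring.
apply: le_trans (_ : X * r ^+ (m - i.+1) * (D * m.+1%:R ^+ d) *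
  (C * m.+1%:R ^+ p * r ^+ n) <= _).
  rewrite ler_pM ?mulr_ge0 ?normr_ge0 //; first rewrite ler_pM //.
    apply: le_trans (hD _ _) _; rewrite ler_wpM2l // natrX_le //.
    by rewrite prednK ?leqnSn // (leq_ltn_trans _ nm).
  apply: le_trans (h n) _; rewrite ler_wpM2r ?exprn_ge0 // ler_wpM2l //.
  by rewrite natrX_le // ltnW.
have -> : X * r ^+ (m - i.+1) * (D * m.+1%:R ^+ d) *
    (C * m.+1%:R ^+ p * r ^+ n) =
  X * (D * m.+1%:R ^+ d) * (C * m.+1%:R ^+ p) * (r ^+ (m - i.+1) * r ^+ n).
  by ring.
rewrite ler_wpM2l ?mulr_ge0 ?exprn_ge0 // -exprD ler_wiXn2l ?(ltW r1) //.
by rewrite -{1}(@subnK i.+1 m) ?leq_add2l // (leq_trans im) // ltnW.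
Qed.

End Operators.
End Bounds.

(** * Limits of complex sequences and series with geometric bounds *)

Section CplxLimits.
Variable R : realType.
Local Notation K := (Cplx R).

Let toC (a : R) : K := real_complex R a.

Lemma toC_ge0E (z : K) : 0 <= z -> exists2 a : R, 0 <= a & z = toC a.
Proof.
move=> z0; have /complex_realP[a za] : (z : R[i]) \is Num.real.
  by rewrite ger0_real.
by exists a => //; move: z0; rewrite za /toC (@ler0c R).
Qed.

Lemma cvg_toC (a : nat -> R) (l : R) : (a @ \oo --> l)%classic ->
  ((fun n => toC (a n)) @ \oo --> toC l)%classic.
Proof.
move=> /cvgrPdist_lt al; apply/cvgrPdist_lt => e e0.
have [c _ ec] := toC_ge0E (ltW e0).
have c0 : 0 < c by move: e0; rewrite ec /toC (@ltcR R 0).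
near=> n.
have -> : toC l - toC (a n) = toC (l - a n) by rewrite /toC rmorphB.
have -> : `|toC (l - a n)| = toC `|l - a n| :> K.
  rewrite [LHS](@normc_def R) /= expr0n addr0 sqrtr_sqr; by [].
rewrite ec /toC (@ltcR R); near: n; exact: al.
Unshelve. all: by end_near. Qed.

Lemma geo_cvg0 (v : nat -> K) (C s : K) : 0 <= C -> 0 <= s -> s < 1 ->
  (forall m, `|v m| <= C * s ^+ m) -> (v @ \oo --> (0 : K))%classic.
Proof.
move=> C0 s0 s1 h.
have [c c0 Cc] := toC_ge0E C0; have [a a0 sa] := toC_ge0E s0.
have a1 : a < 1 by move: s1; rewrite sa /toC (@ltcR R a 1).
have /cvg_toC g0 : (geometric c a @ \oo --> (0 : R))%classic.
  by apply: cvg_geometric; rewrite ger0_norm.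
apply/cvgr0Pnorm_lt => e e0; move/cvgr0Pnorm_lt : g0 => /(_ e e0).
apply: filterS => n; apply: le_lt_trans; apply: le_trans (h n) _.
rewrite Cc sa /geometric /= /toC -rmorphXn -rmorphM /=.
by rewrite real_ler_norm // ger0_real // (@ler0c R) mulr_ge0 // exprn_ge0.
Qed.

Lemma geo_cvg_series_real (v : nat -> R) (c a : R) : 0 <= c -> 0 <= a -> a < 1 ->
  (forall m, `|v m| <= c * a ^+ m) -> cvgn (series v).
Proof.
move=> c0 a0 a1 h; apply: normed_cvg; apply: series_le_cvg (h) _ => //.
- by move=> n; rewrite mulr_ge0 // exprn_ge0.
- by apply: is_cvg_geometric_series; rewrite ger0_norm.
Qed.

(** Real and imaginary parts are dominated by the same real geometric series and converge
    separately. *)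
Lemma geo_cvg_series (u : nat -> K) (C s : K) : 0 <= C -> 0 <= s -> s < 1 ->
  (forall m, `|u m| <= C * s ^+ m) -> exists l : K, (sumlt u @ \oo --> l)%classic.
Proof.
move=> C0 s0 s1 h.
have [c c0 Cc] := toC_ge0E C0; have [a a0 sa] := toC_ge0E s0.
have a1 : a < 1 by move: s1; rewrite sa /toC (@ltcR R a 1).
have hRe (z : R[i]) m : `|z| <= C * s ^+ m :> K -> `|complex.Re z| <= c * a ^+ m.
  move=> zm; rewrite -(@lecR R); apply: le_trans (@normc_ge_Re R z) _.
  by move: zm; rewrite Cc sa /toC -rmorphXn -rmorphM.
have hIm (z : R[i]) m : `|z| <= C * s ^+ m :> K -> `|complex.Im z| <= c * a ^+ m.
  (* The imaginary part of z is minus the real part of iz. *)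
  move=> zm; rewrite -normrN -(@ReiNIm R); apply: hRe.
  have i1 : `|'i%C : R[i]| = 1 by rewrite normc_def /= expr0n expr1n add0r sqrtr1.
  by rewrite normrM i1 mulr1.
have /cvg_ex[/= l1 /cvg_toC cr] :=
  geo_cvg_series_real c0 a0 a1 (fun m => hRe _ _ (h m)).
have /cvg_ex[/= l2 /cvg_toC ci] :=
  geo_cvg_series_real c0 a0 a1 (fun m => hIm _ _ (h m)).
have sE : sumlt u = (fun n => toC (series (fun m => complex.Re (u m)) n) +
    ('i%C : K) * toC (series (fun m => complex.Im (u m)) n)).
  apply: funext => n; rewrite /sumlt /series /= /toC !big_mkord.
  rewrite !rmorph_sum mulr_sumr -big_split /=.
  by apply: eq_bigr => m _; exact: complexE.
rewrite sE; exists (toC l1 + ('i%C : K) * toC l2).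
exact: (cvgD cr (cvgMl_tmp (a := ('i%C : K)) ci)).
Qed.

End CplxLimits.

Lemma derK_lincomb k I (s : seq I) (c : I -> laurent) (F : I -> Halg) :
  derK k (\sum_(i <- s) c i *: F i) = \sum_(i <- s) c i *: derK k (F i).
Proof. by rewrite /derK linear_sum; apply: eq_bigr => i _; exact: derHZ. Qed.

Lemma cvg_lincomb (R : realType) I (s : seq I) (P : pred I) (c : I -> Cplx R)
    (f : I -> nat -> Cplx R) (l : I -> Cplx R) :
  all P s -> (forall i, P i -> (f i @ \oo --> l i)%classic) ->
  ((fun n => \sum_(i <- s) c i * f i n) @ \oo -->
     \sum_(i <- s) c i * l i)%classic.
Proof.
move=> + h; elim: s => [_|i s IHs /= /andP[Pi Ps]].
  rewrite big_nil; under eq_fun do rewrite big_nil.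
  exact: cvg_cst.
rewrite big_cons; under eq_fun do rewrite big_cons.
exact: cvgD (cvgMl_tmp (h _ Pi)) (IHs Ps).
Qed.

(** * Z_q as a limit of partial sums, and the partial sums of derivatives *)

Section Main.
Variables (R : realType) (q : Cplx R).
Hypothesis hq : `|q| < 1.

Local Notation act := (Act (1 - q) (xq q)).
Local Notation act_e ks := (act (eindex ks) (delta0 _)).

Let q1 : 1 - q != 0 := subq_neq0 hq.

(** For m > 0, x_m = q^m (1-q) / (1 - q^m) and |1 - q^m| >= 1 - |q|^m >= 1 - |q|. *)
Lemma xq_le m : `|xq q m| <= `|1 - q| / (1 - `|q|) * `|q| ^+ m.
Proof.
have d0 : 0 < 1 - `|q| by rewrite subr_gt0.
case: m => [|m].
  by rewrite xq0 normr0 mulr_ge0 ?exprn_ge0 // divr_ge0 // ltW.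
rewrite /xq /qint invf_div !normrM normfV normrX mulrC ler_wpM2r ?exprn_ge0 //.
rewrite ler_wpM2l // lef_pV2 ?posrE ?normr_gt0 ?qX_neq1 //.
apply: le_trans (lerB_dist _ _); rewrite normr1 normrX lerD2l lerN2.
by rewrite exprS ler_piMr // exprn_ile1 // ltW.
Qed.

Let X0 : 0 <= `|1 - q| / (1 - `|q|).
Proof. by rewrite divr_ge0 // subr_ge0 ltW. Qed.

Let polybd_mul (c f : nat -> Cplx R) F : (forall m, `|c m| <= F) ->
  polybd f -> polybd (fun m => c m * f m).
Proof.
move=> cF [C [p [C0 h]]]; have F0 : 0 <= F := le_trans (normr_ge0 _) (cF 0%N).
exists (F * C), p; split=> [|m]; first exact: mulr_ge0.
by rewrite normrM -mulrA ler_pM.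
Qed.

Lemma Fx_le j : exists F, forall m,
  `|xq q m ^+ j * (xq q m + (1 - q))| <= F.
Proof.
have xX m := x_le (normr_ge0 q) hq X0 xq_le m.
have cX m := xt_le (1 - q) (normr_ge0 q) hq X0 xq_le m.
eexists => m; rewrite normrM normrX.
apply: ler_pM (cX m) => //; first exact: exprn_ge0.
apply: lerXn2r (xX m); rewrite ?nnegrE //.
Qed.

Lemma polybd_act_e ks : polybd (act_e ks).
Proof.
elim: ks => [|k ks IHks].
  exists 1, 0%N; split=> // m.
  rewrite /eindex big_nil Act1 // mul1r expr0 /delta0.
  by case: eqP; rewrite ?normr1 // normr0.
have e : act_e (k :: ks) = (fun m => Fx q k m * sumlt (act_e ks) m).
  by apply: funext => m; rewrite eindex_cons ActM // act_eNhat.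
rewrite e; case: k {e} => [|k k0].
  exact: polybd_mul (x_le (normr_ge0 q) hq X0 xq_le) (polybd_sumlt IHks).
have [F hF] := Fx_le k.-1.
exact: polybd_mul hF (polybd_sumlt IHks).
Qed.

(** A leading entry [Bar1] or k >= 2 leaves a factor x_m in front of a bounded multiplier; this
    factor supplies the geometric decay. *)
Lemma polybd_geo_act_e ks : admissible ks -> polybd_geo `|q| (act_e ks).
Proof.
case: ks => [_|k ks adm].
  exists 1, 0%N; split=> // m; rewrite /eindex big_nil Act1 // mul1r expr0 mul1r.
  by rewrite /delta0; case: m => [|m]; rewrite ?normr1 // normr0 exprn_ge0.
have pb := polybd_sumlt (polybd_act_e ks).
have e : act_e (k :: ks) = (fun m => Fx q k m * sumlt (act_e ks) m).
  by apply: funext => m; rewrite eindex_cons ActM // act_eNhat.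
rewrite e; case: k adm {e} => [|[|[|k]] // k0] _.
  exact: (polybd_geo_mulx X0 xq_le).
have [F hF] := Fx_le k.
have := polybd_geo_mulx X0 xq_le (polybd_mul hF pb).
rewrite /mulx /Fx /=; under eq_fun do rewrite !mulrA -exprS.
by [].
Qed.

Lemma zeta_lim ks : admissible ks ->
  (sumlt (act_e ks) @ \oo --> zeta q ks)%classic.
Proof.
move=> /polybd_geo_act_e /(polybd_geo_le (normr_ge0 q) hq)[C [s [C0 s0 s1 h]]].
have [l hl] := geo_cvg_series C0 s0 s1 h.
suff -> : zeta q ks = l by [].
apply: cvg_lim; first exact: norm_hausdorff.
(* [zeta_trunc] at N allows m_1 = N, whereas [sumlt] at N stops before N; the shift leaves the limit
   unchanged. *)
have -> : (fun N => zeta_trunc q ks N) = (fun N => sumlt (act_e ks) N.+1).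
  by apply: funext => N; exact: zeta_truncE.
by move: hl; rewrite -cvg_shiftS.
Qed.

Lemma Zq_lim w : H0hat w -> (sumlt (act w (delta0 _)) @ \oo --> Zq q w)%classic.
Proof.
move=> [s ws]; rewrite (Zq_expansion q1 ws); case: ws => sadm ->.
have -> : sumlt (act (\sum_(p <- s) p.1 *: eindex p.2) (delta0 _)) =
    (fun N => \sum_(p <- s) laurent_eval (1 - q) p.1 * sumlt (act_e p.2) N).
  apply: funext => N; rewrite /sumlt; under [RHS]eq_bigr do rewrite mulr_sumr.
  rewrite [RHS]exchange_big; apply: eq_bigr => n _; rewrite Act_sum //.
  by apply: eq_bigr => p _; rewrite ActZ.
apply: (@cvg_lincomb R _ s _ (fun p => laurent_eval (1 - q) p.1)
  (fun p => sumlt (act_e p.2)) (fun p => zeta q p.2) sadm) => p.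
exact: zeta_lim.
Qed.

(** [Act_derK_eindex] turns the derivative into M_k applied after e_k, and [polybd_geo_sumlt_opM]
    makes the partial sums decay. *)
Lemma derK_lim k w : H0hat w ->
  (sumlt (act (derK k w) (delta0 _)) @ \oo --> (0 : Cplx R))%classic.
Proof.
move=> [s [sadm ->]].
have -> : sumlt (act (derK k (\sum_(p <- s) p.1 *: eindex p.2)) (delta0 _)) =
    (fun N => \sum_(p <- s) laurent_eval (1 - q) p.1 *
                sumlt (opM (1 - q) (xq q) k (act_e p.2)) N).
  apply: funext => N; rewrite /sumlt; under [RHS]eq_bigr do rewrite mulr_sumr.
  rewrite [RHS]exchange_big; apply: eq_bigr => n _.
  rewrite derK_lincomb Act_sum //; apply: eq_bigr => p _.
  have E := Act_derK_eindex q1 (xqD hq) (xqc_neq0 hq) k p.2.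
  by rewrite ActZ // E.
have := @cvg_lincomb R _ s _ (fun p => laurent_eval (1 - q) p.1)
  (fun p => sumlt (opM (1 - q) (xq q) k (act_e p.2))) (fun=> 0) sadm.
rewrite [X in (_ --> X)%classic]big1 => [|p _]; last by rewrite mulr0.
apply=> p /polybd_geo_act_e hp.
have := polybd_geo_sumlt_opM (xqD hq) (normr_ge0 q) hq X0 xq_le k hp.
move=> /(polybd_geo_le (normr_ge0 q) hq)[C [z [C0 z0 z1 h]]].
exact: geo_cvg0 C0 z0 z1 h.
Qed.

End Main.

Theorem theorem3p13 (R : realType) (q : Cplx R) (hq : `|q| < 1)
  (n : nat) (hn : (1 <= n)%N) (w : Halg) (hw : H0hat w) :
  H0hat (partialH n w) /\ Zq q (partialH n w) = 0.
Proof.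
have hD := H0hat_derK n.-1 hw; rewrite (partialHE w hn).
split; first exact: espanZ.
have H0 : H0hat 0 by exact: espan0.
have := Zq_linear (subq_neq0 hq) (laurentC ((-1) ^+ n.-1 / n%:R)) hD H0.
rewrite addr0 => ->.
(* The same partial sums converge to this value and to 0. *)
have -> : Zq q (derK n.-1 w) = 0.
  apply: cvg_unique (Zq_lim hq hD) (derK_lim hq _ hw).
  exact: norm_hausdorff.
rewrite mulr0 add0r.
(* The remaining term [Zq q 0] comes from taking [w2 := 0] in [Zq_linear]. *)
apply: cvg_unique (Zq_lim hq H0) _; first exact: norm_hausdorff.
have -> : sumlt (Act (1 - q) (xq q) 0 (delta0 _)) = (fun=> 0 : Cplx R).
  apply: funext => m; rewrite /sumlt big1 // => i _; exact: Act0.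
exact: cvg_cst.
Qed.
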